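(* Let $K$ be a field, $p$ a prime, and $S\le K^\times$ a subgroup containing $-1$ and $K^{\times p}$. Let $T_S\le K^\times$ be the subgroup generated by $S$ together with all $x\in K^\times$ satisfying $1-x\notin\bigcup_{i=0}^{p-1}x^iS$. If $(K^\times:T_S)>p$, then there exists a non-trivial valuation $v$ on $K$ whose value group is not $p$-divisible, i.e. $vK\ne p\,vK$.
   Context: Elements $x\in K^\times$ with $S+xS\subseteq\bigcup_{i=0}^{p-1}x^iS$ are called $p$-rigid (with respect to $S$); $T_S$ is the subgroup generated by $S$ and all non-$p$-rigid elements, equivalently by $S$ and all $x$ with $1-x\notin\bigcup_{i=0}^{p-1}x^iS$ (here $0$ is never in $\bigcup_i x^iS$). *)

(* Defs.v *)
(* MathComp, with the set layer of MathComp-Analysis *)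
From mathcomp Require Import all_boot all_order all_algebra.
From mathcomp Require Import boolp classical_sets functions cardinality.

Set Implicit Arguments.
Unset Strict Implicit.
Unset Printing Implicit Defensive.

Import Order.TTheory GRing.Theory Num.Theory.
Local Open Scope classical_set_scope.
Local Open Scope card_scope.
Local Open Scope ring_scope.

Section MultiplicativeSubgroups.
Variable K : fieldType.
Implicit Types (S T A : set K) (x : K).

Definition punits : set K := [set x | x != 0].

(* Subgroups of K^* are represented as subsets of K that avoid 0. *)
Definition mul_subgroup S : Prop :=
  [/\ S `<=` punits, S 1 & forall x y, S x -> S y -> S (x / y)].

Definition mul_generated A : set K := smallest mul_subgroup A.

Definition coset x S : set K := [set x * s | s in S].

Definition cosets T : set (set K) := [set coset x T | x in punits].

(* The index may be infinite, hence the comparison of cardinals. *)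
Definition index_gt T (n : nat) : Prop := `I_n.+1 #<= cosets T.

Definition power_cosets (p : nat) S x : set K :=
  \bigcup_(i in `I_p) coset (x ^+ i) S.

Definition T_ (p : nat) S : set K :=
  mul_generated
    (S `|` [set x | punits x /\ ~ power_cosets p S x (1 - x)]).

End MultiplicativeSubgroups.

(* A porderZmodType carries no compatibility between order and addition. *)
Definition ordered_abelian_group (G : porderZmodType) : Prop :=
  (forall a b : G, (a <= b) || (b <= a)) /\
  (forall a b c : G, a <= b -> a + c <= b + c).

Section Valuations.
Variables (K : fieldType) (G : porderZmodType).
Implicit Types (a b : option G) (v : K -> option G).

(* option G is G with a largest element None = oo adjoined. *)
Definition oo_add a b : option G :=
  match a, b with
  | Some g, Some h => Some (g + h)
  | _, _ => None
  end.

Definition oo_le a b : bool :=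
  match a, b with
  | _, None => true
  | None, Some _ => false
  | Some g, Some h => g <= h
  end.

Definition oo_min a b : option G := if oo_le a b then a else b.

Record valuation v : Prop := Valuation {
  valuation_group : ordered_abelian_group G ;
  valuation_oo : forall x, v x = None <-> x = 0 ;
  valuationM : forall x y, v (x * y) = oo_add (v x) (v y) ;
  valuationD : forall x y, oo_le (oo_min (v x) (v y)) (v (x + y))
}.

(* the finite values of v, i.e. the image of v on punits K; it may be a proper
   subgroup of G *)
Definition value_group v : set G := [set g | exists x, v x = Some g].

Definition nontrivial_valuation v : Prop := value_group v <> [set 0].

Definition p_divisible_value_group (p : nat) v : Prop :=
  value_group v = [set g *+ p | g in value_group v].

End Valuations.

(* Main.v *)
Require Import Defs.
From HB Require Import structures.
From mathcomp Require Import all_boot all_order all_algebra.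
From mathcomp Require Import boolp classical_sets functions cardinality.
From mathcomp Require Import ring.

Set Implicit Arguments.
Unset Strict Implicit.
Unset Printing Implicit Defensive.

Import Order.TTheory GRing.Theory Num.Theory.
Local Open Scope ring_scope.

(* Write T for T_S and call x rigid when 1 - x lies in S or in xS. If x and y
   are independent modulo T, then p-rigidity places the class of a + b on the
   affine line through the classes of a and b, for suitable a, b in the span of
   x and y in the F_p-space K^*/S. Comparing the resulting lines through
   1 + n x + y shows that x and y are not both non-rigid, since otherwise the
   classes of 1 + n x would be barycentres whose total weight 1 + n r never
   vanishes in F_p. Hence, for odd p, all elements outside some H = <T, u> are
   rigid; for p = 2 this holds already with H = T, but T has to be enlarged by
   a class of elements that behave like units. The elements x outside H with
   1 - x in S, together with the elements of H that stabilise them, then form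
   a valuation ring whose units lie in H (the construction of Arason, Elman,
   Jacob and Ware). As H contains the p-th powers and (K^* : H) > 1, the value
   group K^*/O^* is not p-divisible. *)

Ltac fieldn := field; do ?[apply/andP; split];
  rewrite ?oppr_eq0 ?invr_eq0 ?mulf_neq0 ?oner_neq0 //.

(** * Multiplicative subgroups of a field *)

Section MulSubgroup.
Variables (K : fieldType) (S : set K).
Implicit Types x y : K.
Hypothesis S_subgroup : mul_subgroup S.

Lemma mul_subgroup_neq0 x : S x -> x != 0.
Proof. by case: S_subgroup => + _ _; apply. Qed.

Lemma mul_subgroup_num x y : S (x / y) -> x != 0.
Proof. by move=> /mul_subgroup_neq0; apply: contraNneq => ->; rewrite mul0r. Qed.

Lemma mul_subgroup_den x y : S (x / y) -> y != 0.
Proof. by move=> /mul_subgroup_neq0; apply: contraNneq => ->; rewrite invr0 mulr0. Qed.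

Lemma mul_subgroup1 : S 1.
Proof. by case: S_subgroup. Qed.

Lemma mul_subgroup_div x y : S x -> S y -> S (x / y).
Proof. by case: S_subgroup => _ _; apply. Qed.

Lemma mul_subgroupV x : S x -> S x^-1.
Proof. by rewrite -[x^-1]mul1r; apply: mul_subgroup_div mul_subgroup1. Qed.

Lemma mul_subgroupM x y : S x -> S y -> S (x * y).
Proof. by move=> Sx /mul_subgroupV /(mul_subgroup_div Sx); rewrite invrK. Qed.

Lemma mul_subgroupX x n : S x -> S (x ^+ n).
Proof.
move=> Sx; elim: n => [|n IHn]; first exact: mul_subgroup1.
by rewrite exprS; apply: mul_subgroupM.
Qed.

Lemma mul_subgroupMr x y : S y -> S (x * y) <-> S x.
Proof.
move=> Sy; split=> [Sxy|Sx]; last exact: mul_subgroupM.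
by rewrite -(mulfK (mul_subgroup_neq0 Sy) x); apply: mul_subgroup_div.
Qed.

Lemma mul_subgroupMl x y : S x -> S (x * y) <-> S y.
Proof. by rewrite mulrC; apply: mul_subgroupMr. Qed.

End MulSubgroup.

(** Applied to [- 1], which is its own inverse, the third condition yields closure under opposites,
    and [0 = 1 + (- 1)]. *)
Definition valuation_ring (K : fieldType) (O : set K) : Prop :=
  [/\ forall x y, O x -> O y -> O (x + y),
      forall x y, O x -> O y -> O (x * y) &
      forall x, x != 0 -> O x \/ O x^-1].

(** * The ring attached to rigidity outside a subgroup *)

Section RigidElements.
Variables (K : fieldType) (S H : set K).
Implicit Types x y a b : K.

Definition rigid x := S (1 - x) \/ S ((1 - x) / x).

(** In the ring to be built, these are the elements of the maximal ideal outside [H]. *)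
Definition infinitesimal x := [/\ x != 0, ~ H x & S (1 - x)].

Definition infinitesimal_stabilizer x :=
  H x /\ forall y, infinitesimal y -> infinitesimal (x * y).

Definition rigid_ring : set K :=
  [set x | [\/ x = 0, infinitesimal x | infinitesimal_stabilizer x]].

Hypothesis S_subgroup : mul_subgroup S.
Hypothesis H_subgroup : mul_subgroup H.
Hypothesis SH : forall x, S x -> H x.
Hypothesis S_opp1 : S (- 1).
Hypothesis rigidH : forall x, x != 0 -> ~ H x -> rigid x.

Local Notation O1 := infinitesimal.
Local Notation O2 := infinitesimal_stabilizer.
Local Notation O := rigid_ring.
Let S0 := mul_subgroup_neq0 S_subgroup.
Let SM := mul_subgroupM S_subgroup.
Let Sdiv := mul_subgroup_div S_subgroup.
Let SV := mul_subgroupV S_subgroup.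
Let HM := mul_subgroupM H_subgroup.
Let HV := mul_subgroupV H_subgroup.

Lemma mul_subgroupN x : S x -> S (- x).
Proof. by rewrite -mulN1r; apply: SM. Qed.

Lemma mul_subgroupV_out x : ~ H x -> ~ H x^-1.
Proof. by move=> Hx /HV; rewrite invrK. Qed.

(** Rigidity of [- (b / a)] puts [a + b] into [a S] or [b S]. The class of the sum enters through a
    representative [d], so that it can be compared with known classes. *)
Lemma rigidD c d a b : c = a + b -> a != 0 -> b != 0 -> ~ H (b / a) ->
  S (c / d) -> S (d / a) \/ S (d / b).
Proof.
move=> -> a0 b0 Hba Scd.
have c0 := mul_subgroup_num S_subgroup Scd; have d0 := mul_subgroup_den S_subgroup Scd.
have HN : ~ H (- (b / a)).
  by rewrite -mulN1r (mul_subgroupMl H_subgroup) //; apply: SH.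
have cE : 1 - - (b / a) = (a + b) / a by fieldn.
case: (rigidH _ HN) => [|h|h]; first by rewrite oppr_eq0 mulf_neq0 ?invr_eq0.
  left; rewrite (_ : d / a = (1 - - (b / a)) / ((a + b) / d)); first exact: Sdiv.
  by fieldn.
right; rewrite (_ : d / b = - (((1 - - (b / a)) / - (b / a)) / ((a + b) / d))).
  exact/mul_subgroupN/Sdiv.
by rewrite cE; fieldn.
Qed.

(** If [1 - x] lies in [x S], then [1 - x^-1 = - (1 - x) / x] lies in [S]. *)
Lemma infinitesimal_inv x : x != 0 -> ~ H x -> O1 x \/ O1 x^-1.
Proof.
move=> x0 Hx; case: (rigidH x0 Hx) => h; first by left.
right; split; rewrite ?invr_eq0 //; first exact: mul_subgroupV_out.
suff -> : 1 - x^-1 = - ((1 - x) / x) by apply: mul_subgroupN.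
by field.
Qed.

(** If [1 - x] and [1 - x^-1] both lay in [S], so would [x], being minus their quotient. *)
Lemma infinitesimal_asym x : O1 x -> ~ O1 x^-1.
Proof.
move=> [x0 Hx Sx] [_ _ SVx]; apply/Hx/SH.
have e : 1 - x^-1 = - ((1 - x) / x) by fieldn.
have ? := S0 Sx; rewrite (_ : x = - ((1 - x) / (1 - x^-1))); last by rewrite e; fieldn.
by apply/mul_subgroupN/Sdiv.
Qed.

(** Otherwise [1 - x y] lies in [x y S]. By the splitting [(1 - x) + x (1 - y)] it also lies in [S]
    or [x S], which forces [x y] or [y] into [S]. *)
Lemma infinitesimalM x y : O1 x -> O1 y -> ~ H (x * y) -> O1 (x * y).
Proof.
move=> [x0 Hx Sx] [y0 Hy Sy] Hxy; have xy0 : x * y != 0 by rewrite mulf_neq0.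
split=> //; case: (rigidH xy0 Hxy) => // h.
have ? := S0 Sx; have ? := S0 Sy.
have nH : ~ H (x * (1 - y) / (1 - x)).
  move=> h'; apply: Hx; move: h'; rewrite -mulrA.
  by rewrite (mul_subgroupMr H_subgroup) //; apply/SH/Sdiv.
have e : 1 - x * y = 1 - x + x * (1 - y) by ring.
case: (rigidD e _ _ nH h); rewrite ?mulf_neq0 ?oner_neq0 //.
  by rewrite (mul_subgroupMr S_subgroup) => [/SH//|]; apply: SV.
rewrite (_ : _ / _ = y / (1 - y)); last by fieldn.
by rewrite (mul_subgroupMr S_subgroup) => [/SH//|]; apply: SV.
Qed.

(** As for products, with the splitting [(1 - y) - a y] of [1 - (1 + a) y]: failure would force
    [(1 + a) y] or [a] into [S]. *)
Lemma infinitesimal_1DM a y : O1 a -> O1 y -> S (1 + a) -> ~ H (a * y) ->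
  O1 ((1 + a) * y).
Proof.
move=> [a0 Ha Sa] [y0 Hy Sy] S1a Hay.
have s0 := S0 S1a; have sy0 : (1 + a) * y != 0 by rewrite mulf_neq0.
have Hsy : ~ H ((1 + a) * y) by rewrite (mul_subgroupMl H_subgroup) //; apply: SH.
split=> //; case: (rigidH sy0 Hsy) => // h; have y10 := S0 Sy.
have nH : ~ H (- (a * y) / (1 - y)).
  rewrite (mul_subgroupMr H_subgroup); last exact/HV/SH.
  by rewrite -mulN1r (mul_subgroupMl H_subgroup) //; apply: SH.
have e : 1 - (1 + a) * y = 1 - y + - (a * y) by ring.
case: (rigidD e _ _ nH h) => //; first by rewrite oppr_eq0 mulf_neq0.
  by rewrite (mul_subgroupMr S_subgroup) => [/SH//|]; apply: SV.
rewrite (_ : _ / _ = - ((1 + a) / a)) => [/mul_subgroupN|]; last by fieldn.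
by rewrite opprK (mul_subgroupMl S_subgroup) // => /SV; rewrite invrK => /SH.
Qed.

(** These three closure properties are established separately for odd [p] and for [p = 2]. Granted
    them, the ring is treated uniformly. *)
Hypothesis O1M3 : forall x y z, O1 x -> O1 y -> O1 z ->
  ~ H (x * y * z) -> O1 (x * y * z).
Hypothesis O1_1DM : forall a y, O1 a -> O1 y -> S (1 + a) -> O1 ((1 + a) * y).
Hypothesis O2_1DM : forall a y, S a -> S (1 + a) ->
  (forall z, O1 z -> O1 (a * z)) -> O1 y -> O1 ((1 + a) * y).

Lemma O1M_stab x y : O1 x -> O1 y -> H (x * y) -> O2 (x * y).
Proof.
move=> x1 y1 Hxy; split=> // z z1; apply: O1M3 => //.
by rewrite (mul_subgroupMl H_subgroup) //; case: z1.
Qed.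

Lemma rigid_ringM x y : O x -> O y -> O (x * y).
Proof.
case=> [->|x1|[Hx x2]]; first by rewrite mul0r; constructor 1.
  case=> [->|y1|[Hy y2]]; first by rewrite mulr0; constructor 1.
    have [Hxy|Hxy] := pselect (H (x * y)); first by constructor 3; apply: O1M_stab.
    by constructor 2; apply: infinitesimalM.
  by constructor 2; rewrite mulrC; apply: y2.
case=> [->|y1|[Hy y2]]; first by rewrite mulr0; constructor 1.
  by constructor 2; apply: x2.
constructor 3; split; first exact: HM.
by move=> z z1; rewrite -mulrA; apply/x2/y2.
Qed.

Lemma rigid_ringV x : x != 0 -> O x \/ O x^-1.
Proof.
move=> x0; have [Hx|Hx] := pselect (H x); last first.
  by case: (infinitesimal_inv x0 Hx); [left|right]; constructor 2.
have [x2|/existsNP[y /not_implyP[y1 nxy]]] := pselect (forall y, O1 y -> O1 (x * y)).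
  by left; constructor 3.
(* As [x y] is not infinitesimal, its inverse is, and [x^-1 = (x y)^-1 y] is a product of two
   infinitesimals. *)
right; constructor 3; have [y0 Hy _] := y1.
have nH : ~ H (x * y) by rewrite (mul_subgroupMl H_subgroup).
have [//|xyV] := infinitesimal_inv (mulf_neq0 x0 y0) nH.
rewrite (_ : x^-1 = (x * y)^-1 * y); last by fieldn.
apply: O1M_stab => //; rewrite (_ : _ * _ = x^-1); last by fieldn.
exact: HV.
Qed.

Lemma rigid_ring_unit x : x != 0 -> O x -> O x^-1 -> H x.
Proof.
move=> x0 [/eqP|x1|[]//]; first by rewrite (negPf x0).
case=> [/eqP|xV1|[/HV]]; first by rewrite invr_eq0 (negPf x0).
  by case: (infinitesimal_asym x1).
by rewrite invrK.
Qed.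

Lemma rigid_ringN1 : O (- 1).
Proof. by case: (@rigid_ringV (-1)); rewrite ?invrN1 // oppr_eq0 oner_eq0. Qed.

Lemma infinitesimalN x : O1 x -> O1 (- x).
Proof.
move=> x1; have [x0 Hx _] := x1.
have HN : ~ H (- x) by rewrite -mulN1r (mul_subgroupMl H_subgroup) //; apply: SH.
have : O (-1 * x) by apply: rigid_ringM rigid_ringN1 _; constructor 2.
by rewrite mulN1r => -[/eqP||[]//]; first by rewrite oppr_eq0 (negPf x0).
Qed.

Lemma rigid_ring1D a : O a -> O (1 + a).
Proof.
case=> [->|a1|[Ha a2]].
- by rewrite addr0; case: (@rigid_ringV 1); rewrite ?invr1 ?oner_neq0.
- have [_ _] := infinitesimalN a1; rewrite opprK => S1a.
  by constructor 3; split=> [|y y1]; [apply: SH|apply: O1_1DM].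
have [->|s0] := eqVneq (1 + a) 0; first by constructor 1.
have a0 := mul_subgroup_neq0 H_subgroup Ha.
have [Hs|Hs] := pselect (H (1 + a)); last first.
  (* If [b = (1 + a)^-1] were infinitesimal, so would be [a b], and [1 - a b = b] would lie in
     [S]. *)
  have [|b1] := infinitesimal_inv s0 Hs; first by constructor 2.
  have [b0 Hb _] := b1; case: Hb; apply: SH.
  have [_ _] := a2 _ b1.
  by rewrite (_ : 1 - _ = (1 + a)^-1) //; fieldn.
constructor 3; split=> // y y1.
have [[y0 Hy Sy] ay1] := (y1, a2 _ y1); have [ay0 Hay Say] := ay1.
have sy0 : (1 + a) * y != 0 by rewrite mulf_neq0.
have Hsy : ~ H ((1 + a) * y) by rewrite (mul_subgroupMl H_subgroup).
have [//|h] := rigidH sy0 Hsy.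
have [[Sa Ss]|nS] := pselect (S a /\ S (1 + a)); first exact: O2_1DM.
have H_S z w : ~ H z -> S w -> ~ H (- z / w).
  move=> Hz Sw; rewrite (mul_subgroupMr H_subgroup); last exact/HV/SH.
  by rewrite -mulN1r (mul_subgroupMl H_subgroup) //; apply: SH.
(* Comparing two splittings of [1 - (1 + a) y] puts both [(1 + a) / a] and [1 + a] into [S], hence
   also [a]: the case already settled. *)
have e1 : 1 - (1 + a) * y = 1 - y + - (a * y) by ring.
have e2 : 1 - (1 + a) * y = 1 - a * y + - y by ring.
have Sas : S ((1 + a) / a).
  have ayN0 : - (a * y) != 0 by rewrite oppr_eq0.
  case: (rigidD e1 (S0 Sy) ayN0 (H_S _ _ Hay Sy) h).
    by rewrite (mul_subgroupMr S_subgroup _ (SV Sy)) => /SH.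
  rewrite (_ : _ / _ = - ((1 + a) / a)) => [/mul_subgroupN|]; last by fieldn.
  by rewrite opprK.
suff Ss : S (1 + a).
  by case: nS; split=> //; have := Sdiv Ss Sas; rewrite (_ : _ / _ = a) //; fieldn.
have yN0 : - y != 0 by rewrite oppr_eq0.
case: (rigidD e2 (S0 Say) yN0 (H_S _ _ Hy Say) h).
  by rewrite (mul_subgroupMr S_subgroup _ (SV Say)) => /SH.
rewrite (_ : _ / _ = - (1 + a)) => [/mul_subgroupN|]; last by fieldn.
by rewrite opprK.
Qed.

Lemma rigid_ring_valuation : valuation_ring O.
Proof.
split=> [x y Ox Oy||]; [|exact: rigid_ringM|exact: rigid_ringV].
have [->|x0] := eqVneq x 0; first by rewrite add0r.
have [->|y0] := eqVneq y 0; first by rewrite addr0.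
have [|h] : O (x / y) \/ O (y / x).
- have /rigid_ringV : x / y != 0 by rewrite mulf_neq0 ?invr_eq0.
  by rewrite invf_div.
- move=> /rigid_ring1D/rigid_ringM/(_ Oy).
  by rewrite (_ : _ * _ = x + y) //; fieldn.
rewrite (_ : x + y = (1 + y / x) * x); last by fieldn.
exact/rigid_ringM/Ox/rigid_ring1D.
Qed.

End RigidElements.

(** * Odd primes *)

Section RigidRingOdd.
Variables (K : fieldType) (S H : set K).
Implicit Types x y a b : K.

Hypothesis S_subgroup : mul_subgroup S.
Hypothesis H_subgroup : mul_subgroup H.
Hypothesis SH : forall x, S x -> H x.
Hypothesis S_opp1 : S (- 1).
Hypothesis rigidH : forall x, x != 0 -> ~ H x -> rigid S x.
Hypothesis H_sqr : forall x, H (x ^+ 2) -> H x.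

Local Notation O1 := (infinitesimal S H).
Let SM := mul_subgroupM S_subgroup.
Let HM := mul_subgroupM H_subgroup.
Let SV := mul_subgroupV S_subgroup.
Let rigidD := rigidD S_subgroup H_subgroup SH S_opp1 rigidH.
Let O1M := infinitesimalM S_subgroup H_subgroup SH S_opp1 rigidH.

(** If some pairwise product is outside [H], multiply in that order. Otherwise
    [x^2 = (x y) (x z) / (y z)] lies in [H], hence so does [x], which is absurd. *)
Lemma infinitesimalM3_odd x y z : O1 x -> O1 y -> O1 z ->
  ~ H (x * y * z) -> O1 (x * y * z).
Proof.
move=> x1 y1 z1 Hxyz.
have [Hxy|Hxy] := pselect (H (x * y)); last by apply: O1M => //; apply: O1M.
have [Hyz|Hyz] := pselect (H (y * z)); last first.
  by rewrite -mulrA; apply: O1M => //; rewrite ?mulrA //; apply: O1M.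
have [Hxz|Hxz] := pselect (H (x * z)); last first.
  by rewrite mulrAC; apply: O1M => //; rewrite 1?mulrAC //; apply: O1M.
have [x0 Hx _] := x1; have [y0 _ _] := y1; have [z0 _ _] := z1.
case: Hx; apply: H_sqr.
rewrite (_ : x ^+ 2 = x * y * (x * z) / (y * z)); last by fieldn.
by apply: (mul_subgroup_div H_subgroup) => //; apply: (mul_subgroupM H_subgroup).
Qed.

Lemma infinitesimal_1DM_odd a y : O1 a -> O1 y -> S (1 + a) ->
  O1 ((1 + a) * y).
Proof.
move=> a1 y1 Ss; have [[a0 Ha Sa] [y0 Hy Sy]] := (a1, y1).
have [Hay|Hay] := pselect (H (a * y)); last first.
  exact: infinitesimal_1DM.
have s0 := mul_subgroup_neq0 S_subgroup Ss.
have sy0 : (1 + a) * y != 0 by rewrite mulf_neq0.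
have Hsy : ~ H ((1 + a) * y) by rewrite (mul_subgroupMl H_subgroup) //; apply: SH.
split=> //; case: (rigidH sy0 Hsy) => // h.
(* The left side lies in [S], the terms on the right in [y S] and [a S]. Since [a y] is in [H],
   [a / y] agrees with [a^2] modulo [H], so these classes are independent. *)
have e : (1 - y) * (1 + a) = 1 - (1 + a) * y + a by ring.
have d0 := mul_subgroup_num S_subgroup h.
have nH : ~ H (a / (1 - (1 + a) * y)).
  move=> h'; apply/Ha/H_sqr.
  rewrite (_ : a ^+ 2 = a / (1 - (1 + a) * y)
    * ((1 - (1 + a) * y) / ((1 + a) * y)) * (1 + a) * (a * y)).
    exact: HM (HM (HM h' (SH h)) (SH Ss)) Hay.
  by fieldn.
have h1 : S ((1 - y) * (1 + a) / 1) by rewrite divr1; apply: SM.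
case: (rigidD e d0 a0 nH h1) => [/(SM h)|]; last first.
  by rewrite mul1r => /SV/SH; rewrite invrK.
rewrite (_ : _ / _ * (1 / _) = ((1 + a) * y)^-1) => [/SV/SH|]; last by fieldn.
by rewrite invrK.
Qed.

Lemma infinitesimal_stabilizer_1DM_odd a y : S a -> S (1 + a) ->
  (forall z, O1 z -> O1 (a * z)) -> O1 y -> O1 ((1 + a) * y).
Proof.
move=> Sa Ss a2 y1; have [[y0 Hy Sy] [_ Hay Say]] := (y1, a2 _ y1).
have a0 := mul_subgroup_neq0 S_subgroup Sa.
have s0 := mul_subgroup_neq0 S_subgroup Ss.
have sy0 : (1 + a) * y != 0 by rewrite mulf_neq0.
have Hsy : ~ H ((1 + a) * y) by rewrite (mul_subgroupMl H_subgroup) //; apply: SH.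
split=> //; case: (rigidH sy0 Hsy) => // h.
(* The left side lies in [S], the terms on the right in [y S] and [y^2 S], while neither [y] nor
   [y^2] is in [H]. *)
have e : (1 - y) * (1 - a * y) = 1 - (1 + a) * y + a * y ^+ 2 by ring.
have d0 := mul_subgroup_num S_subgroup h.
have nH : ~ H (a * y ^+ 2 / (1 - (1 + a) * y)).
  move=> h'; apply: Hy.
  rewrite (_ : y = a * y ^+ 2 / (1 - (1 + a) * y)
    * ((1 - (1 + a) * y) / ((1 + a) * y)) * (1 + a) * a^-1).
    exact: HM (HM (HM h' (SH h)) (SH Ss)) (SH (SV Sa)).
  by fieldn.
have h1 : S ((1 - y) * (1 - a * y) / 1) by rewrite divr1; apply: SM.
have b0 : a * y ^+ 2 != 0 by rewrite !mulf_neq0.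
case: (rigidD e d0 b0 nH h1) => [/(SM h)|].
  rewrite (_ : _ / _ * (1 / _) = ((1 + a) * y)^-1) => [/SV/SH|]; last by fieldn.
  by rewrite invrK.
rewrite mul1r => /SV; rewrite invrK (mul_subgroupMl S_subgroup) // => /SH/H_sqr.
by [].
Qed.

Lemma rigid_ring_valuation_odd : valuation_ring (rigid_ring S H).
Proof.
apply: rigid_ring_valuation => //.
- exact: infinitesimalM3_odd.
- exact: infinitesimal_1DM_odd.
- exact: infinitesimal_stabilizer_1DM_odd.
Qed.

End RigidRingOdd.

(** * The prime 2 *)

Section Adjoin.
Variables (K : fieldType) (p : nat) (H : set K).
Implicit Types x y u : K.

(** The subgroup generated by [H] and [u], as the union of the [u^-n H]; natural exponents suffice
    because [u^p] will lie in [H]. *)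
Definition adjoin u : set K := [set x | exists n, H (x * u ^+ n)].

Hypothesis H_subgroup : mul_subgroup H.
Hypothesis p_gt0 : (0 < p)%N.
Hypothesis H_powers : forall x, x != 0 -> H (x ^+ p).

Lemma sub_adjoin u x : H x -> adjoin u x.
Proof. by move=> Hx; exists 0%N; rewrite expr0 mulr1. Qed.

Lemma adjoin_subgroup u : u != 0 -> mul_subgroup (adjoin u).
Proof.
move=> u0; split=> [x [n /(mul_subgroup_neq0 H_subgroup)]||x y [n Hx] [m Hy]].
- by rewrite mulf_eq0 negb_or => /andP[x0 _]; exact: x0.
- by apply/sub_adjoin; apply: mul_subgroup1.
have um0 : u ^+ m != 0 by rewrite expf_neq0.
have := mul_subgroup_neq0 H_subgroup Hy; rewrite mulf_eq0 negb_or => /andP[y0 _].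
(* The exponent [n - m] is made natural by adding [m p]. *)
exists (n + m * p.-1)%N; rewrite (_ : _ * _ = x * u ^+ n / (y * u ^+ m) * (u ^+ m) ^+ p).
  apply: (mul_subgroupM H_subgroup); last exact: H_powers.
  exact: mul_subgroup_div.
by rewrite -(prednK p_gt0) exprS prednK // exprD exprM; fieldn.
Qed.

End Adjoin.

(** * The valuation ring when [H] contains the squares *)

Section RigidRingTwo.
Variables (K : fieldType) (S H : set K).
Implicit Types x y z a b s t u v w : K.

Hypothesis S_subgroup : mul_subgroup S.
Hypothesis H_subgroup : mul_subgroup H.
Hypothesis SH : forall x, S x -> H x.
Hypothesis S_opp1 : S (- 1).
Hypothesis rigidH : forall x, x != 0 -> ~ H x -> rigid S x.
Hypothesis H_sqr : forall x, x != 0 -> H (x ^+ 2).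

Local Notation O1 := (infinitesimal S H).
Let SM := mul_subgroupM S_subgroup.
Let SV := mul_subgroupV S_subgroup.
Let S0 := mul_subgroup_neq0 S_subgroup.
Let HM := mul_subgroupM H_subgroup.
Let HV := mul_subgroupV H_subgroup.
Let rigidD := rigidD S_subgroup H_subgroup SH S_opp1 rigidH.
Let O1M := infinitesimalM S_subgroup H_subgroup SH S_opp1 rigidH.
Let O1_inv := infinitesimal_inv S_subgroup H_subgroup S_opp1 rigidH.
Let O1_neq0 x : O1 x -> x != 0. Proof. by case. Qed.
Let O1_H x : O1 x -> ~ H x. Proof. by case. Qed.
Let SN := mul_subgroupN S_subgroup S_opp1.
Let HN x : H (- x) <-> H x.
Proof. by rewrite -mulN1r (mul_subgroupMl H_subgroup) //; apply: SH. Qed.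

Lemma sqr_divE x y : y != 0 -> H (x / y) <-> H (x * y).
Proof.
move=> y0; rewrite (_ : x * y = x / y * y ^+ 2); last by fieldn.
by rewrite (mul_subgroupMr H_subgroup _ (H_sqr y0)).
Qed.

(* An element outside [H] that would be a unit of the valuation to be found. *)
Definition unit_like u := [/\ u != 0, ~ H u &
  forall w, O1 w -> ~ H (u * w) -> O1 (u * w) /\ O1 (w / u)].

Lemma unit_likeV u : unit_like u -> unit_like u^-1.
Proof.
move=> [u0 Hu uP]; split; rewrite ?invr_eq0 //; first by move/HV; rewrite invrK.
move=> w w1 nH; have nH' : ~ H (u * w).
  by rewrite mulrC -sqr_divE // mulrC.
by have [] := uP _ w1 nH'; rewrite invrK [u^-1 * w]mulrC [w * u]mulrC.
Qed.

(** If both are infinitesimal and [u v] is outside [H], then [u / v] and [v / u] are infinitesimal,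
    which is absurd. Passing to inverses, which changes no class modulo [H], reduces to this
    case. *)
Lemma unit_like_mul u v : unit_like u -> unit_like v -> H (u * v).
Proof.
have key x y : unit_like x -> unit_like y -> O1 x -> O1 y -> H (x * y).
  move=> [x0 Hx xP] [y0 Hy yP] x1 y1; apply: contrapT => nH.
  have nH' : ~ H (y * x) by rewrite mulrC.
  have [[_ xy] [_ yx]] := (xP _ y1 nH, yP _ x1 nH').
  by apply: (infinitesimal_asym S_subgroup SH S_opp1 xy); rewrite invf_div.
have HVl x y : x != 0 -> H (x^-1 * y) <-> H (x * y).
  by move=> x0; rewrite ![_ * y]mulrC sqr_divE.
have HVr x y : y != 0 -> H (x * y^-1) <-> H (x * y).
  exact: sqr_divE.
move=> ul vl; have [[u0 Hu _] [v0 Hv _]] := (ul, vl).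
have [ulV vlV] := (unit_likeV ul, unit_likeV vl).
case: (O1_inv u0 Hu) => u1; case: (O1_inv v0 Hv) => v1.
- exact: key.
- by rewrite -HVr //; apply: key.
- by rewrite -HVl //; apply: key.
- by rewrite -HVl // -HVr //; apply: key.
Qed.

(** Here [w / y = (s w) t] is a product of infinitesimals. Meant for an [s y] that is not
    infinitesimal, with inverse [t]. *)
Lemma unit_like_test s t y : O1 y -> O1 t -> H s -> t * (s * y) = 1 ->
  (forall w, O1 w -> ~ H (y * w) -> O1 (s * w)) -> unit_like y.
Proof.
move=> y1 t1 Hs tsy sP; have y0 := O1_neq0 y1; split=> // [|w w1 nH].
  exact: O1_H.
split; first exact: O1M.
have e : w / y = s * w * t.
  by apply: (mulIf y0); rewrite divfK // -[LHS]mulr1 -tsy; ring.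
rewrite e; apply: O1M => //; first exact: sP.
by rewrite -e sqr_divE // mulrC.
Qed.

(** By the splittings [(1 - x) - y] and [(1 - y) - x], failure would put the element into both [y S]
    and [x S], so that [x / y] would lie in [S]. *)
Lemma infinitesimal_1BB x y : O1 x -> O1 y -> ~ H (x / y) -> S (1 - x - y).
Proof.
move=> [x0 Hx Sx] [y0 Hy Sy] nH.
have c0 : 1 - x - y != 0.
  by rewrite subr_eq0; apply: contra_not_neq Hy => <-; apply: SH.
have cc : S ((1 - x - y) / (1 - x - y)) by rewrite divff //; apply: mul_subgroup1.
have nHx : ~ H (- y / (1 - x)).
  by rewrite (mul_subgroupMr H_subgroup) ?HN //; apply/HV/SH.
have nHy : ~ H (- x / (1 - y)).
  by rewrite (mul_subgroupMr H_subgroup) ?HN //; apply/HV/SH.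
have [xN0 yN0] : - x != 0 /\ - y != 0 by rewrite !oppr_eq0.
have e : 1 - x - y = 1 - y + - x by ring.
case: (rigidD (erefl (1 - x - y)) (S0 Sx) yN0 nHx cc) => [h|hy].
  by have := SM h Sx; rewrite divfK //; apply: S0.
case: (rigidD e (S0 Sy) xN0 nHy cc) => [h|hx].
  by have := SM h Sy; rewrite divfK //; apply: S0.
case: nH; apply: SH; have := SM (SV hx) hy.
by rewrite (_ : _ * _ = x / y) //; fieldn.
Qed.

(** The element [1 - y - a z = (1 - (1 + a) z) - (y - z)] lies in [S], whereas the terms on the
    right would lie in the independent classes [z S] and [y S]. *)
Lemma not_infinitesimal_1DM a y z : S a -> S (1 + a) ->
  O1 y -> O1 (a * z) -> ~ H (y / z) -> ~ H z ->
  S ((1 - (1 + a) * z) / ((1 + a) * z)) -> ~ S ((y - z) / y).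
Proof.
move=> Sa Ss y1 az1 nH Hz hz hy.
have [[a0 s0] y0] := (S0 Sa, S0 Ss, O1_neq0 y1).
have z0 : z != 0 by have := O1_neq0 az1; rewrite mulf_eq0 negb_or => /andP[].
have yz0 := mul_subgroup_num S_subgroup hy; have d0 := mul_subgroup_num S_subgroup hz.
have nH1 : ~ H (y / (a * z)).
  rewrite (_ : _ / _ = y / z / a); last by fieldn.
  by rewrite (mul_subgroupMr H_subgroup) //; apply/HV/SH.
have := infinitesimal_1BB y1 az1 nH1; rewrite -[_ - _ - _]divr1 => h.
have e : 1 - y - a * z = 1 - (1 + a) * z + - (y - z) by ring.
have nH2 : ~ H (- (y - z) / (1 - (1 + a) * z)).
  move=> h'; apply: nH.
  have := HM (HM h' (SH hz)) (HM (SH (SV hy)) (SH Ss)).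
  by rewrite (_ : _ * _ * _ = - (y / z)) ?HN //; fieldn.
have yzN0 : - (y - z) != 0 by rewrite oppr_eq0.
case: (rigidD e d0 yzN0 nH2 h) => h'; [apply: Hz|apply: (O1_H y1)]; apply: SH.
  have := SV (SM (SM hz h') Ss).
  by rewrite (_ : (_ * _ * _)^-1 = z) //; fieldn.
have := SV (SM hy h'); rewrite (_ : (_ / _ * (1 / _))^-1 = - y) => [/SN|]; last by fieldn.
by rewrite opprK.
Qed.

(** If both failed, rigidity would put [y - z] into [y S] or [z S]; [not_infinitesimal_1DM] excludes
    the first, and the second after exchanging [y] and [z]. *)
Lemma infinitesimal_1DM_either a y z : S a -> S (1 + a) ->
  O1 y -> O1 z -> O1 (a * y) -> O1 (a * z) -> ~ H (y / z) ->
  O1 ((1 + a) * y) \/ O1 ((1 + a) * z).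
Proof.
move=> Sa Ss y1 z1 ay1 az1 nH.
have [[s0 y0] z0] := (S0 Ss, O1_neq0 y1, O1_neq0 z1).
have nHs x : ~ H x -> ~ H ((1 + a) * x).
  by rewrite (mul_subgroupMl H_subgroup) //; apply: SH.
have [sy0 sz0] : (1 + a) * y != 0 /\ (1 + a) * z != 0 by rewrite !mulf_neq0.
have nHy := nHs _ (O1_H y1); have nHz := nHs _ (O1_H z1).
case: (rigidH sy0 nHy) => hy; first by left; split.
case: (rigidH sz0 nHz) => hz; first by right; split.
have c0 : y - z != 0.
  rewrite subr_eq0; apply: contra_not_neq nH => ->; rewrite divff //.
  exact: mul_subgroup1.
have cc : S ((y - z) / (y - z)) by rewrite divff //; apply: mul_subgroup1.
have nH1 : ~ H (- z / y).
  by rewrite mulNr HN; move/HV; rewrite invf_div.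
have zN0 : - z != 0 by rewrite oppr_eq0.
case: (rigidD (erefl (y - z)) y0 zN0 nH1 cc) => h; exfalso.
  exact: not_infinitesimal_1DM Sa Ss y1 az1 nH (O1_H z1) hz h.
have nH2 : ~ H (z / y) by move/HV; rewrite invf_div.
apply: not_infinitesimal_1DM Sa Ss z1 ay1 nH2 (O1_H y1) hy _.
by rewrite (_ : _ / _ = (y - z) / - z) //; fieldn.
Qed.

Lemma adjoin_sqr u x : u != 0 -> adjoin H u x -> H x \/ H (x * u).
Proof.
move=> u0 [n]; rewrite -(odd_double_half n) exprD -muln2 mulnC exprM mulrA.
rewrite (mul_subgroupMr H_subgroup) => [|]; last exact/(mul_subgroupX H_subgroup)/H_sqr.
by case: odd; rewrite ?expr0 ?mulr1; [right|left].
Qed.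

Lemma rigid_ring_valuation_two :
  exists u, u != 0 /\ valuation_ring (rigid_ring S (adjoin H u)).
Proof.
(* [u] represents the only class of unit-like elements modulo [H]; it is [1] if there are none. *)
have [u [u0 uP ulP]] : exists u, [/\ u != 0, H u \/ unit_like u &
    forall v, unit_like v -> adjoin H u v].
  have [[u ul]|nul] := pselect (exists u, unit_like u).
    exists u; split; [by case: ul|by right|].
    by move=> v vl; exists 1%N; apply: unit_like_mul.
  exists 1; split; rewrite ?oner_neq0 //; first by left; apply: mul_subgroup1.
  by move=> v vl; case: nul; exists v.
exists u; split=> //; set H' := adjoin H u.
have H'_subgroup : mul_subgroup H' by apply: (@adjoin_subgroup _ 2).
have HH' x : H x -> H' x := @sub_adjoin _ _ _ _.
have SH' x : S x -> H' x by move=> /SH/HH'.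
have rigidH' x : x != 0 -> ~ H' x -> rigid S x.
  by move=> x0 H'x; apply: rigidH => // /HH'.
have O1E x : infinitesimal S H' x <-> O1 x /\ ~ H' x.
  split=> [[x0 H'x Sx]|[[x0 Hx Sx] H'x]]; last by split.
  by do !split=> //; move=> /HH'.
have H'M x y : H' x -> H' (x * y) <-> H' y by apply: (mul_subgroupMl H'_subgroup).
(* If [s y] were not infinitesimal, its inverse would be, and [y] would be unit-like, hence in
   [H']. *)
have test s y : O1 y -> ~ H' y -> H s ->
    (forall w, O1 w -> ~ H (y * w) -> O1 (s * w)) -> O1 (s * y).
  move=> y1 H'y Hs sP; have y0 := O1_neq0 y1.
  have s0 := mul_subgroup_neq0 H_subgroup Hs.
  have sy0 : s * y != 0 by rewrite mulf_neq0.
  have nH : ~ H (s * y) by rewrite (mul_subgroupMl H_subgroup) //; apply: O1_H.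
  case: (O1_inv sy0 nH) => // t1; case: H'y; apply: ulP.
  by apply: unit_like_test y1 t1 Hs _ sP; rewrite mulVf.
apply: (rigid_ring_valuation S_subgroup H'_subgroup) => //.
- move=> x y z /O1E[x1 H'x] /O1E[y1 H'y] /O1E[z1 H'z] nH'.
  apply/O1E; split=> //; have nH : ~ H (x * y * z) by move=> /HH'.
  have [Hxy|Hxy] := pselect (H (x * y)); last by apply: O1M => //; apply: O1M.
  have [Hyz|Hyz] := pselect (H (y * z)); last first.
    by rewrite -mulrA; apply: O1M => //; rewrite ?mulrA //; apply: O1M.
  (* As [y z] is in [H], [y] and [z] agree modulo [H], so [x (y w)] is reached by products that stay
     outside [H]. *)
  apply: test => // w w1 nHzw; rewrite -mulrA.
  have nHxw : ~ H (y * w).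
    move=> Hyw; apply: nHzw; have y0 := O1_neq0 y1.
    have := mul_subgroup_div H_subgroup (HM Hyz Hyw) (H_sqr y0).
    by rewrite (_ : _ / _ = z * w) //; fieldn.
  apply: O1M => //; first exact: O1M.
  by rewrite mulrA (mul_subgroupMl H_subgroup) //; apply: O1_H.
- move=> a y /O1E[a1 H'a] /O1E[y1 H'y] Ss; apply/O1E; split; last first.
    by rewrite H'M //; apply: SH'.
  have [Hay|Hay] := pselect (H (a * y)); last exact: infinitesimal_1DM.
  apply: test => // [|w w1 nHyw]; first exact: SH.
  apply: infinitesimal_1DM => // Haw; apply: nHyw; have a0 := O1_neq0 a1.
  have := mul_subgroup_div H_subgroup (HM Hay Haw) (H_sqr a0).
  by rewrite (_ : _ / _ = y * w) //; fieldn.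
move=> a y Sa Ss a2 /O1E[y1 H'y]; apply/O1E; split; last first.
  by rewrite H'M //; apply: SH'.
have aP w : O1 w -> ~ H' w -> O1 (a * w).
  by move=> w1 H'w; have /O1E/a2/O1E[] := conj w1 H'w.
have y0 := O1_neq0 y1.
have [Hu|ul] : H u \/ (unit_like u /\ ~ H u).
- by have [|nHu] := pselect (H u); [left|case: uP => // ul; right].
- have H'H w : ~ H w -> ~ H' w.
    move=> nHw /(adjoin_sqr u0)[//|]; rewrite (mul_subgroupMr H_subgroup) //.
  (* If [(1 + a) y] fails, [(1 + a) w] succeeds for every infinitesimal [w] independent of [y],
     which is what [test] asks for. *)
  have [//|nsy] := pselect (O1 ((1 + a) * y)).
  apply: test => // [|w w1 nHyw]; first exact: SH.
  have nyw : ~ H (y / w) by rewrite sqr_divE //; apply: O1_neq0.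
  have aw1 := aP _ w1 (H'H _ (O1_H w1)).
  by have [] := infinitesimal_1DM_either Sa Ss y1 w1 (aP _ y1 H'y) aw1 nyw.
(* Here [y] is compared with [u y]: if [(1 + a) u y] is infinitesimal, dividing by the unit-like [u]
   keeps it so. *)
have [[_ _ ulP1] nHu] := ul.
have H'u : H' u by exists 1%N; rewrite expr1; apply: H_sqr.
have nHuy : ~ H (u * y) by move=> Huy; apply: H'y; exists 1%N; rewrite expr1 mulrC.
have [z1 _] := ulP1 _ y1 nHuy.
have nH'z : ~ H' (u * y) by rewrite H'M.
have nyz : ~ H (y / (u * y)).
  by rewrite (_ : _ / _ = u^-1) => [/HV|]; [rewrite invrK|fieldn].
have [//|w1] := infinitesimal_1DM_either Sa Ss y1 z1 (aP _ y1 H'y) (aP _ z1 nH'z) nyz.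
have nHw : ~ H (u * ((1 + a) * (u * y))).
  rewrite (_ : _ * _ = u ^+ 2 * ((1 + a) * y)); last by ring.
  rewrite (mul_subgroupMl H_subgroup _ (H_sqr u0)).
  by rewrite (mul_subgroupMl H_subgroup _ (SH Ss)); apply: O1_H.
have [_] := ulP1 _ w1 nHw.
by rewrite (_ : _ / _ = (1 + a) * y) //; fieldn.
Qed.

End RigidRingTwo.

(** * Non-rigid elements are dependent *)

Section PlaneExponents.
(* [F] stands for the prime field ['F_p]. *)
Variables (K F : fieldType) (p : nat) (S H : set K) (x y : K).
Implicit Types (a b z : K) (m n : F).

Hypothesis F_pchar : p \in [pchar F].
Hypothesis F_nat : forall m, exists i, m = i%:R.
Hypothesis S_subgroup : mul_subgroup S.
Hypothesis H_subgroup : mul_subgroup H.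
Hypothesis SH : forall z, S z -> H z.
Hypothesis S_opp1 : S (- 1).
Hypothesis S_powers : forall z, z != 0 -> S (z ^+ p).
Hypothesis p_rigidH : forall z, z != 0 -> ~ H z -> power_cosets p S z (1 - z).
Hypothesis x_neq0 : x != 0.
Hypothesis y_neq0 : y != 0.
Hypothesis xy_indep : forall i j, H (x ^+ i * y ^+ j) -> (p %| i)%N /\ (p %| j)%N.

Let SM := mul_subgroupM S_subgroup.
Let SV := mul_subgroupV S_subgroup.
Let SX := mul_subgroupX S_subgroup.

(* Coordinates of the class of [a] in the plane spanned by [x] and [y] in the
   [F]-space [K^* / S]. *)
Definition exponents a m n := exists i j : nat,
  [/\ i%:R = m, j%:R = n & S (a / (x ^+ i * y ^+ j))].

Let p_prime : prime p := pcharf_prime F_pchar.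
Let natFp_eq0 i : (i%:R == 0 :> F) = (p %| i)%N.
Proof. by rewrite -(dvdn_pcharf F_pchar). Qed.

Lemma exponents_neq0 a m n : exponents a m n -> a != 0.
Proof. by case=> i [j [_ _ /mul_subgroup_num]]; apply. Qed.

Lemma exponentsM a b m n m' n' : exponents a m n -> exponents b m' n' ->
  exponents (a * b) (m + m') (n + n').
Proof.
move=> [i [j [<- <- Sa]]] [i' [j' [<- <- Sb]]].
exists (i + i')%N, (j + j')%N; rewrite !natrD; split=> //.
have := SM Sa Sb; rewrite mulrACA -invfM; congr (S (_ / _)).
by rewrite !exprD; ring.
Qed.

Lemma exponents1 : exponents 1 0 0.
Proof.
exists 0%N, 0%N; split=> //; rewrite !expr0 mulr1 divr1.
exact: mul_subgroup1.
Qed.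

Lemma exponentsX a m n t : exponents a m n -> exponents (a ^+ t) (t%:R * m) (t%:R * n).
Proof.
move=> aE; elim: t => [|t IHt]; first by rewrite expr0 !mul0r; apply: exponents1.
have e k : t.+1%:R * k = k + t%:R * k :> F by rewrite -natr1; ring.
by rewrite exprS !e; apply: exponentsM.
Qed.

Lemma exponents_S a b m n : S b -> exponents a m n -> exponents (b * a) m n.
Proof.
move=> Sb [i [j [<- <- Sa]]]; exists i, j; split=> //.
by rewrite -mulrA; apply: SM.
Qed.

Lemma exponentsV a m n : exponents a m n -> exponents a^-1 (- m) (- n).
Proof.
move=> aE; have a0 := exponents_neq0 aE.
(* Inverses are [(p - 1)]-st powers modulo [S]. *)
have e : p.-1%:R = - 1 :> F.
  by apply/eqP; rewrite -addr_eq0 natr1 natFp_eq0 prednK ?prime_gt0.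
rewrite (_ : a^-1 = (a ^+ p)^-1 * a ^+ p.-1).
  rewrite -(mulN1r m) -(mulN1r n) -e; apply: exponents_S; last exact: exponentsX.
  exact/SV/S_powers.
have ap0 := expf_neq0 p.-1 a0.
by rewrite -{1}(prednK (prime_gt0 p_prime)) exprS; fieldn.
Qed.

Lemma exponents_x : exponents x 1 0.
Proof.
exists 1%N, 0%N; split=> //; rewrite expr1 expr0 mulr1 divff //.
exact: mul_subgroup1.
Qed.

Lemma exponents_y : exponents y 0 1.
Proof.
exists 0%N, 1%N; split=> //; rewrite expr1 expr0 mul1r divff //.
exact: mul_subgroup1.
Qed.

Lemma exponents_H a m n : exponents a m n -> H a -> m = 0 /\ n = 0.
Proof.
move=> [i [j [<- <- Sa]]] Ha; have ij0 := mul_subgroup_den S_subgroup Sa.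
have a0 := mul_subgroup_num S_subgroup Sa.
have [|pi pj] := @xy_indep i j.
  have := mul_subgroupM H_subgroup (SH (SV Sa)) Ha.
  by rewrite invf_div divfK.
by split; apply/eqP; rewrite natFp_eq0.
Qed.

Lemma exponents_uniq a m n m' n' : exponents a m n -> exponents a m' n' ->
  m = m' /\ n = n'.
Proof.
move=> aE aE'; have a0 := exponents_neq0 aE.
have := exponentsM aE (exponentsV aE'); rewrite divff // => /exponents_H.
by move=> /(_ (mul_subgroup1 H_subgroup)) [/eqP + /eqP]; rewrite !subr_eq0 => /eqP-> /eqP->.
Qed.

Lemma exponents0_S a : exponents a 0 0 -> S a.
Proof.
move=> [i [j [/eqP + /eqP +]]]; rewrite !natFp_eq0 => /dvdnP[k ->] /dvdnP[l ->].
rewrite (mul_subgroupMr S_subgroup) //; apply: SV.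
by rewrite !exprM; apply: SM; apply: S_powers; apply: expf_neq0.
Qed.

Lemma exponents_eq a b m n : exponents a m n -> exponents b m n -> S (a / b).
Proof.
by move=> aE bE; apply: exponents0_S; have := exponentsM aE (exponentsV bE); rewrite !subrr.
Qed.

(* The geometric form of [p]-rigidity. *)
Lemma exponentsD a b m n m' n' : exponents a m n -> exponents b m' n' ->
  m != m' \/ n != n' ->
  exists t : F, exponents (a + b) (m + t * (m' - m)) (n + t * (n' - n)).
Proof.
move=> aE bE ne; have [a0 b0] := (exponents_neq0 aE, exponents_neq0 bE).
have baE := exponentsM bE (exponentsV aE).
have nH : ~ H (- (b / a)).
  rewrite -mulN1r (mul_subgroupMl H_subgroup _ (SH S_opp1)).
  move=> /(exponents_H baE)[/eqP + /eqP]; rewrite !subr_eq0 => /eqP m'E /eqP n'E.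
  by case: ne => /eqP; rewrite ?m'E ?n'E.
have [|i _ [s Ss e]] := p_rigidH _ nH; first by rewrite oppr_eq0 mulf_neq0 ?invr_eq0.
(* The exponent given by [p]-rigidity of [- (b / a)] is the parameter of the point on the line. *)
exists i%:R; rewrite (_ : a + b = (-1) ^+ i * s * (a * (b / a) ^+ i)).
  by apply: exponents_S; [apply: SM => //; apply: SX|apply/exponentsM/exponentsX].
have -> : a + b = a * (1 - - (b / a)) by fieldn.
by rewrite -e (exprNn (b / a)); ring.
Qed.

(* If neither [y] nor [y / x] is rigid then the classes of [1 + n x] and
   [1 + n x + y] are the barycentres of the points [0], [x], [y] with weights
   [(1, n r, 0)] and [(1, n r, s)], where the weights [r], [s] in [F] are
   non-zero. The total weight [1 + n r] would then never vanish in [F]. *)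
Lemma nonrigid_dependent : ~ rigid S (- y) -> ~ rigid S (- (y / x)) -> False.
Proof.
move=> ny nyx.
have ne01 : 0 != 1 :> F by rewrite eq_sym oner_neq0.
have [j] := exponentsD exponents1 exponents_y (or_intror ne01).
rewrite subrr mulr0 !addr0 subr0 mulr1 add0r => jE.
have [k] := exponentsD exponents_x exponents_y (or_introl (oner_neq0 _)).
rewrite sub0r subr0 mulr1 add0r mulrN1 => kE.
(* Non-rigidity keeps [1 + y] out of the classes of [1] and [y], and [x + y] out of those of [x] and
   [y]. *)
have j0 : j != 0.
  apply: contra_not_neq ny => j0; left; rewrite opprK; apply: exponents0_S.
  by rewrite j0 in jE.
have j1 : 1 - j != 0.
  apply: contra_not_neq ny => /eqP; rewrite subr_eq0 => /eqP j1; right.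
  rewrite opprK invrN mulrN; apply: mul_subgroupN => //.
  by apply: exponents_eq jE _; rewrite -j1; apply: exponents_y.
have k0 : k != 0.
  apply: contra_not_neq nyx => k0; left.
  rewrite (_ : 1 - _ = (x + y) / x); last by fieldn.
  by apply: exponents_eq kE _; rewrite k0 subr0; apply: exponents_x.
have k1 : 1 - k != 0.
  apply: contra_not_neq nyx => /eqP; rewrite subr_eq0 => /eqP k1; right.
  rewrite (_ : _ / _ = - ((x + y) / y)); last by fieldn.
  apply: mul_subgroupN => //.
  by apply: exponents_eq kE _; rewrite -k1 subrr; apply: exponents_y.
(* The weights [1], [r], [s] of [1], [x], [y] are chosen so that [j = s / (1 + s)] and
   [k = s / (r + s)]. *)
pose s := j / (1 - j); pose r := s * (1 - k) / k.
have s0 : s != 0 by rewrite mulf_neq0 ?invr_eq0.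
have r0 : r != 0 by rewrite !mulf_neq0 ?invr_eq0.
have rs : r + s = s / k by rewrite /r; fieldn.
have rs0 : r + s != 0 by rewrite rs mulf_neq0 ?invr_eq0.
have s1E : 1 + s = (1 - j)^-1 by rewrite /s; fieldn.
have s10 : 1 + s != 0 by rewrite s1E invr_eq0.
have jE' : j = s / (1 + s) by rewrite s1E /s; fieldn.
have kE1 : k = s / (r + s) by rewrite rs invf_div mulrCA divff // mulr1.
clearbody r s.
have inv (n : nat) : let N := n%:R * r in [/\ 1 + N != 0, 1 + N + s != 0,
    exponents (1 + n%:R * x) (N / (1 + N)) 0 &
    exponents (1 + n%:R * x + y) (N / (1 + N + s)) (s / (1 + N + s))].
  elim: n => [|n [N0 D0 zE wE]].
    rewrite /= !mul0r !addr0 -jE'; split; rewrite ?oner_neq0 //.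
    exact: exponents1.
  move: zE wE; set N := n%:R * r in N0 D0 *; set z := 1 + n%:R * x => zE wE.
  have -> : n.+1%:R * r = N + r by rewrite -natr1 mulrDl mul1r.
  have z'E : 1 + n.+1%:R * x = z + x by rewrite -natr1 mulrDl mul1r addrA.
  rewrite z'E; have sD0 : s / (1 + N + s) != 0 by rewrite mulf_neq0 ?invr_eq0.
  (* The point of [z + x + y] is where the line through [z + y] and [x] meets the line through [z]
     and [x + y]. *)
  have [t wx1] := exponentsD wE exponents_x (or_intror sD0).
  have [u wx2] : exists u, exponents (z + (x + y))
      (N / (1 + N) + u * (1 - k - N / (1 + N))) (0 + u * (k - 0)).
    by apply: exponentsD zE kE _; right; rewrite eq_sym.
  have wxE : z + y + x = z + (x + y) by ring.
  rewrite wxE in wx1; have [E1 E2] := exponents_uniq wx1 wx2.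
  have tE : t = 1 - u * k * (1 + N + s) / s.
    have -> : u * k = s / (1 + N + s) + t * (0 - s / (1 + N + s)) by rewrite E2; ring.
    by fieldn.
  have uE : u * (1 + N + r + s) = r + s.
    apply/eqP; rewrite eq_sym -subr_eq0; apply/eqP.
    have -> : r + s - u * (1 + N + r + s) = (N / (1 + N + s) +
      t * (1 - N / (1 + N + s)) - (N / (1 + N) + u * (1 - k - N / (1 + N)))) *
      ((1 + N) * (r + s)) by rewrite tE kE1; fieldn.
    by rewrite E1 subrr mul0r.
  have D'0 : 1 + N + r + s != 0.
    by apply: contra_neq rs0 => D'0; rewrite -uE D'0 mulr0.
  have {}uE : u = (r + s) / (1 + N + r + s) by rewrite -uE mulfK.
  have wx : exponents (z + x + y) ((N + r) / (1 + N + r + s)) (s / (1 + N + r + s)).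
    move: wx2; rewrite addrA; congr exponents; rewrite uE kE1; fieldn.
  have [q zx] : exists q, exponents (z + x) q 0.
    have ne : N / (1 + N) != 1.
      apply/negP => /eqP e; have /eqP := divfK N0 N.
      by rewrite e mul1r eq_sym eq_sym -subr_eq0 addrK oner_eq0.
    have [q] := exponentsD zE exponents_x (or_introl ne).
    by rewrite subrr mulr0 addr0; exists (N / (1 + N) + q * (1 - N / (1 + N))).
  (* [z + x] lies on the first axis and is collinear with [y] and [z + x + y], which determines
     [q]. *)
  have [v] := exponentsD zx exponents_y (or_intror ne01).
  rewrite sub0r subr0 mulr1 add0r => zxy.
  have [E3 E4] := exponents_uniq zxy wx.
  (* Otherwise [v = 1], so the first coordinate and with it [N + r] vanish, giving [1 = 0]. *)
  have N'0 : 1 + N + r != 0.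
    apply/negP => /eqP N'0; move: E3; rewrite E4 N'0 add0r divff // mul1r subrr.
    move=> /esym /eqP; rewrite mulf_eq0 invr_eq0 (negPf s0) orbF => /eqP Nr.
    by move/eqP: N'0; rewrite -addrA Nr addr0 oner_eq0.
  rewrite /= !addrA; split=> //.
  rewrite (_ : _ / _ = q) //; move: E3; rewrite E4 => E3.
  have -> : N + r = (N + r) / (1 + N + r + s) * (1 + N + r + s) by fieldn.
  by rewrite -E3; fieldn.
(* For this [n] the weight [1 + n r] vanishes. *)
have [n nE] := F_nat (- r^-1); have [+ _ _ _] := inv n.
by rewrite -nE mulNr mulVf // subrr eqxx.
Qed.

End PlaneExponents.

(** * From valuation rings to valuations *)

Section ValuationOfRing.
Variables (K : fieldType) (O : set K).
Hypothesis O_valuation : valuation_ring O.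
Implicit Types x y : K.

Let OD x y : O x -> O y -> O (x + y). Proof. by case: O_valuation => + _ _; apply. Qed.
Let OM x y : O x -> O y -> O (x * y). Proof. by case: O_valuation => _ + _; apply. Qed.
Let OV x : x != 0 -> O x \/ O x^-1. Proof. by case: O_valuation => _ _; apply. Qed.

Lemma valuation_ring1 : O 1.
Proof. by case: (OV (oner_neq0 K)); rewrite ?invr1. Qed.

(** Equality up to a unit of [O], made boolean so that [choose] can pick representatives. *)
Definition associate x y := [&& x != 0, y != 0 & `[< O (x / y) /\ O (y / x) >]].

Lemma associateP x y : x != 0 -> y != 0 ->
  reflect (O (x / y) /\ O (y / x)) (associate x y).
Proof. by rewrite /associate => -> ->; apply: asboolP. Qed.

Lemma associate_refl x : x != 0 -> associate x x.
Proof. by move=> x0; apply/associateP; rewrite // divff //; split; apply: valuation_ring1. Qed.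

Lemma associate_sym x y : associate x y = associate y x.
Proof. by rewrite /associate andbCA; do 2 congr (_ && _); apply/asboolP/asboolP => -[]. Qed.

Lemma associate_trans y x z : associate x y -> associate y z -> associate x z.
Proof.
move=> /and3P[x0 y0 /asboolP[xy yx]] /and3P[_ z0 /asboolP[yz zy]].
apply/associateP => //.
by split; [have := OM xy yz|have := OM zy yx]; rewrite mulrA divfK.
Qed.

Lemma associateM x y x' y' : associate x x' -> associate y y' ->
  associate (x * y) (x' * y').
Proof.
move=> /and3P[x0 x'0 /asboolP[xx' x'x]] /and3P[y0 y'0 /asboolP[yy' y'y]].
apply/associateP; rewrite ?mulf_neq0 // -!mulf_div.
by split; apply: OM.
Qed.

(** [choose] agrees on extensionally equal predicates whatever witness it is given, so the result
    depends only on the class. *)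
Definition associate_repr x := choose (associate x) x.

Lemma associate_reprP x : x != 0 -> associate x (associate_repr x).
Proof. by move=> x0; apply/chooseP/associate_refl. Qed.

Lemma associate_repr_eq x y : associate x y -> associate_repr x = associate_repr y.
Proof.
move=> xy; rewrite /associate_repr (@eq_choose _ (associate x) (associate y)).
  by apply: choose_id; rewrite ?associate_refl // 1?associate_sym //; case/and3P: xy.
move=> z; apply/idP/idP; apply: associate_trans => //.
by rewrite associate_sym.
Qed.

(* The value group [K^* / O^*], each class being encoded by a representative. *)
Definition valuation_group of valuation_ring O :=
  {x : K | (x != 0) && (associate_repr x == x)}.
Local Notation G := (valuation_group O_valuation).

HB.instance Definition _ := SubChoice.on G.

Lemma associate_repr_subproof x (x0 : x != 0) :
  (associate_repr x != 0) && (associate_repr (associate_repr x) == associate_repr x).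
Proof.
have xr := associate_reprP x0; case/and3P: (xr) => _ -> _ /=.
by rewrite -(associate_repr_eq xr).
Qed.

(** At [0] the default is the class of [1]; [ring_valuation] treats [0] apart. *)
Definition valuation_proj x : G :=
  match eqVneq x 0 with
  | NeqNotEq x0 => Sub (associate_repr _) (associate_repr_subproof x0)
  | _ => Sub (associate_repr _) (associate_repr_subproof (oner_neq0 K))
  end.

Lemma valuation_projP x : x != 0 -> associate x (val (valuation_proj x)).
Proof.
move=> x0; rewrite /valuation_proj; case: eqVneq x0 => // x0 _.
by rewrite SubK; apply: associate_reprP.
Qed.

Lemma valuation_group_neq0 (g : G) : val g != 0.
Proof. by case: g => x /= /andP[]. Qed.
Hint Resolve valuation_group_neq0 : core.

Lemma valuation_proj_eq x y : x != 0 -> y != 0 ->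
  valuation_proj x = valuation_proj y <-> associate x y.
Proof.
move=> x0 y0; split=> [e|xy].
  apply: associate_trans (valuation_projP x0) _.
  by rewrite e associate_sym; apply: valuation_projP.
apply: val_inj; rewrite /valuation_proj; case: eqVneq x0 => // x0 _.
by case: eqVneq y0 => //= y0 _; apply: associate_repr_eq.
Qed.

Lemma valuation_valK (g : G) : valuation_proj (val g) = g.
Proof.
apply: val_inj; have g0 := valuation_group_neq0 g.
rewrite /valuation_proj; case: eqVneq g0 => //= g0 _.
by case: g {g0} => x /= /andP[_ /eqP].
Qed.

Definition valuation_group_zero : G := valuation_proj 1.
Definition valuation_group_opp (g : G) : G := valuation_proj (val g)^-1.
Definition valuation_group_add (g h : G) : G := valuation_proj (val g * val h).
Definition valuation_group_le (g h : G) : bool := `[< O (val h / val g) >].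

Lemma valuation_projM x y : x != 0 -> y != 0 ->
  valuation_proj (x * y) = valuation_group_add (valuation_proj x) (valuation_proj y).
Proof.
move=> x0 y0; apply/valuation_proj_eq; rewrite ?mulf_neq0 //.
by apply: associateM; apply: valuation_projP.
Qed.

Lemma valuation_proj_le x y : x != 0 -> y != 0 ->
  valuation_group_le (valuation_proj x) (valuation_proj y) = `[< O (y / x) >].
Proof.
move=> x0 y0; have /and3P[_ _ /asboolP[xx' x'x]] := valuation_projP x0.
have /and3P[_ _ /asboolP[yy' y'y]] := valuation_projP y0.
have [gx0 gy0] := (valuation_group_neq0 (valuation_proj x),
  valuation_group_neq0 (valuation_proj y)).
apply/asboolP/asboolP => h.
  by have := OM (OM yy' h) x'x; rewrite !mulrA !divfK.
by have := OM (OM y'y h) xx'; rewrite !mulrA !divfK.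
Qed.

Lemma valuation_group_addA : associative valuation_group_add.
Proof.
move=> g h k; rewrite -[g]valuation_valK -[h]valuation_valK -[k]valuation_valK.
by rewrite -!valuation_projM ?mulf_neq0 // mulrA.
Qed.

Lemma valuation_group_addC : commutative valuation_group_add.
Proof. by move=> g h; rewrite /valuation_group_add mulrC. Qed.

Lemma valuation_group_add0 : left_id valuation_group_zero valuation_group_add.
Proof.
move=> g; rewrite -[g in LHS]valuation_valK -valuation_projM ?oner_neq0 // mul1r.
exact: valuation_valK.
Qed.

Lemma valuation_group_addN :
  left_inverse valuation_group_zero valuation_group_opp valuation_group_add.
Proof.
move=> g; rewrite /valuation_group_opp -{2}[g]valuation_valK -valuation_projM ?invr_eq0 //.
by rewrite mulVf.
Qed.

HB.instance Definition _ := GRing.isZmodule.Build G valuation_group_addA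
  valuation_group_addC valuation_group_add0 valuation_group_addN.

Lemma valuation_group_le_refl : reflexive valuation_group_le.
Proof. by move=> g; apply/asboolP; rewrite divff //; apply: valuation_ring1. Qed.

Lemma valuation_group_le_anti : antisymmetric valuation_group_le.
Proof.
move=> g h /andP[/asboolP gh /asboolP hg].
rewrite -[g]valuation_valK -[h]valuation_valK; apply/valuation_proj_eq => //.
exact/associateP.
Qed.

Lemma valuation_group_le_trans : transitive valuation_group_le.
Proof.
move=> h g k /asboolP gh /asboolP hk; apply/asboolP.
by have := OM hk gh; rewrite mulrA divfK.
Qed.

Lemma valuation_group_le_total g h :
  valuation_group_le g h || valuation_group_le h g.
Proof.
have : val h / val g != 0 by rewrite mulf_neq0 ?invr_eq0.
move=> /OV; rewrite invf_div /valuation_group_le.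
by case=> /asboolP ->; rewrite ?orbT.
Qed.

Lemma valuation_group_leD g h k : valuation_group_le g h ->
  valuation_group_le (valuation_group_add g k) (valuation_group_add h k).
Proof.
rewrite valuation_proj_le ?mulf_neq0 // => /asboolP gh; apply/asboolP.
by rewrite -mulf_div divff // mulr1.
Qed.

HB.instance Definition _ := Order.Le_isPOrder.Build ring_display G
  valuation_group_le_refl valuation_group_le_anti valuation_group_le_trans.

Definition ring_valuation x : option G :=
  if x == 0 then None else Some (valuation_proj x).

Lemma ring_valuationP : valuation ring_valuation.
Proof.
split.
- by split; [exact: valuation_group_le_total|exact: valuation_group_leD].
- move=> x; rewrite /ring_valuation; case: eqVneq => // x0; split=> // /eqP.
  by rewrite (negPf x0).
- move=> x y; rewrite /ring_valuation mulf_eq0; case: eqVneq => //= x0.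
  by case: eqVneq => //= y0; rewrite valuation_projM.
move=> x y; rewrite /ring_valuation /oo_min.
have [->|x0] := eqVneq x 0.
  by rewrite add0r; case: eqVneq => //= y0; rewrite lexx.
have [->|y0] := eqVneq y 0; first by rewrite addr0 (negPf x0) /= lexx.
have [_|xy0] := eqVneq (x + y) 0; first by case: ifP.
have O1 := valuation_ring1.
have le_proj a b : a != 0 -> b != 0 ->
  (valuation_proj a <= valuation_proj b) = `[< O (b / a) >] by exact: valuation_proj_le.
(* If [y / x] is in [O], the minimum is the value of [x] and [(x + y) / x = 1 + y / x] is in [O];
   otherwise exchange [x] and [y]. *)
rewrite /= le_proj //; case: asboolP => [yx|nyx] /=.
  by rewrite le_proj //; apply/asboolP; rewrite mulrDl divff //; exact: OD.
rewrite /= le_proj //; apply/asboolP; rewrite mulrDl divff //; apply: OD => //.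
have /OV : y / x != 0 by rewrite mulf_neq0 ?invr_eq0.
by rewrite invf_div => -[].
Qed.

Lemma ring_valuation_eq x y : x != 0 -> y != 0 ->
  ring_valuation x = ring_valuation y -> O (x / y) /\ O (y / x).
Proof.
move=> x0 y0; rewrite /ring_valuation (negPf x0) (negPf y0) => -[].
by move=> /(valuation_proj_eq x0 y0)/associateP; apply.
Qed.

End ValuationOfRing.

Lemma valuationX (K : fieldType) (G : porderZmodType) (v : K -> option G) x g n :
  valuation v -> v x = Some g -> v (x ^+ n) = Some (g *+ n).
Proof.
move=> [_ v_oo vM _] vx.
have [h v1] : exists h, v 1 = Some h.
  by case: (v 1) (v_oo 1) => [h|[/(_ erefl)/eqP]]; [exists h|rewrite oner_eq0].
have h0 : h = 0.
  have := vM 1 1; rewrite mulr1 v1 => -[/eqP].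
  by rewrite -[X in X == _]addr0 (inj_eq (addrI h)) eq_sym => /eqP.
elim: n => [|n IHn]; first by rewrite expr0 mulr0n v1 h0.
by rewrite exprS vM vx IHn mulrS.
Qed.

(** If the value of [x] were [p] times that of [y], then [x / y^p] would be a unit, hence in [H],
    and so would be [x]. *)
Lemma valuation_ring_not_p_divisible (K : fieldType) (p : nat) (O H : set K) :
  valuation_ring O -> mul_subgroup H -> (0 < p)%N ->
  (forall x, x != 0 -> O x -> O x^-1 -> H x) ->
  (forall x, x != 0 -> H (x ^+ p)) -> (exists2 x, x != 0 & ~ H x) ->
  exists (G : porderZmodType) (v : K -> option G),
    [/\ valuation v, nontrivial_valuation v & ~ p_divisible_value_group p v].
Proof.
move=> hO H_subgroup p_gt0 OH H_powers [x x0 Hx].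
pose v := ring_valuation hO; have vP : valuation v := ring_valuationP hO.
have ndiv : ~ p_divisible_value_group p v.
  case: vP (vP) => _ v_oo _ _ vP; rewrite /p_divisible_value_group => e.
  case vx : (v x) => [g|]; last by move/v_oo: vx x0 => ->; rewrite eqxx.
  have : value_group v g by exists x.
  rewrite e => -[h [y vy] hg].
  have y0 : y != 0 by apply: contraPneq vy => /v_oo ->.
  have yp0 : y ^+ p != 0 by rewrite expf_neq0.
  have [|xy yx] := @ring_valuation_eq _ _ hO x (y ^+ p) x0 yp0.
    by rewrite -/v (valuationX _ vP vy) vx hg.
  apply: Hx; rewrite -(divfK yp0 x).
  apply: (mul_subgroupM H_subgroup); last exact: H_powers.
  by apply: OH; rewrite ?mulf_neq0 ?invr_eq0 // invf_div.
(* A trivial value group would be [p]-divisible. *)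
exists (valuation_group hO), v; split=> // e; apply: ndiv.
rewrite /p_divisible_value_group e; apply/seteqP; split=> [_ ->|_ [_ -> <-]].
  by exists 0; rewrite ?mul0rn.
by rewrite /= mul0rn.
Qed.

(** * The subgroup [T_] *)

Lemma coset_eq (K : fieldType) (H : set K) (x y : K) :
  mul_subgroup H -> H (x / y) -> coset x H = coset y H.
Proof.
move=> H_subgroup Hxy; have x0 := mul_subgroup_num H_subgroup Hxy.
have y0 := mul_subgroup_den H_subgroup Hxy.
apply/seteqP; split=> _ [s Hs <-].
  by exists (x / y * s); [apply: (mul_subgroupM H_subgroup)|fieldn].
by exists (s / (x / y)); [apply: (mul_subgroup_div H_subgroup)|fieldn].
Qed.

(** * Index and roots for subgroups containing the [p]-th powers *)

Section PrimePowers.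
Variables (K : fieldType) (p : nat) (H : set K).
Hypothesis p_prime : prime p.
Hypothesis H_subgroup : mul_subgroup H.
Hypothesis H_powers : forall x, x != 0 -> H (x ^+ p).

(** By Bezout, [k n = l p + 1] for some [k] and [l], so [x] is [x^(k n)] divided by a [p]-th
    power. *)
Lemma mul_subgroup_expr_mem x n : x != 0 -> ~~ (p %| n)%N -> H (x ^+ n) -> H x.
Proof.
move=> x0; rewrite -prime_coprime // coprime_sym => /eqP cop Hxn.
have n_gt0 : (0 < n)%N.
  by case: n cop {Hxn} => //; rewrite gcd0n => p1; move: (prime_gt1 p_prime); rewrite p1.
case: (egcdnP p n_gt0) => k l; rewrite cop => e _.
have xlp0 : x ^+ (l * p) != 0 by rewrite expf_neq0.
rewrite -[x](mulKf xlp0) -exprSr -addn1 -e [(k * n)%N]mulnC (exprM x n k).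
apply: (mul_subgroupM H_subgroup); last exact: (mul_subgroupX H_subgroup).
by apply: (mul_subgroupV H_subgroup); rewrite exprM; apply/H_powers/expf_neq0.
Qed.

Lemma adjoin_gen u : u != 0 -> adjoin H u u.
Proof. by exists p.-1; rewrite -exprS prednK ?prime_gt0 //; apply: H_powers. Qed.

(** Otherwise the cosets of [u^-i] with [i < p] would be all cosets of [H], and the index would be
    at most [p]. *)
Lemma adjoin_proper u : index_gt H p -> u != 0 ->
  exists2 z, z != 0 & ~ adjoin H u z.
Proof.
move=> H_index u0; apply: contrapT => nex.
suff : (`I_p.+1 #<= `I_p)%card by rewrite card_le_II ltnn.
apply: card_le_trans H_index _.
apply: card_le_trans (card_image_le (fun i => coset (u^-1 ^+ i) H) _).
apply: subset_card_le => _ [z z0 <-].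
have [n Hzn] : adjoin H u z by apply: contrapT => nz; apply: nex; exists z.
exists (n %% p)%N; first by rewrite /= ltn_pmod ?prime_gt0.
have uV0 : u^-1 != 0 by rewrite invr_eq0.
apply/esym/(coset_eq H_subgroup).
rewrite (_ : _ / _ = z * u ^+ n / (u ^+ (n %/ p)) ^+ p).
  by apply: (mul_subgroup_div H_subgroup) => //; apply/H_powers/expf_neq0.
have unp0 := expf_neq0 p (expf_neq0 (n %/ p) u0).
by rewrite [in u ^+ n](divn_eq n p) exprD exprM exprVn invrK; fieldn.
Qed.

End PrimePowers.

(** * Rigidity outside [T] and the resulting valuation ring *)

Section MainTheorem.
Variables (K : fieldType) (p : nat) (S : set K).
Hypothesis p_prime : prime p.
Hypothesis S_subgroup : mul_subgroup S.
Hypothesis S_opp1 : S (- 1).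
Hypothesis S_powers : forall x : K, x != 0 -> S (x ^+ p).

Local Notation T := (T_ p S).

Lemma T_mul_subgroup : mul_subgroup T.
Proof.
split=> [x Tx||x y Tx Ty].
(* [punits] is itself a subgroup containing the generators. *)
- apply: (Tx (@punits K)); split=> [|z [/(mul_subgroup_neq0 S_subgroup)//|[]//]].
  split=> // [|a b a0 b0]; rewrite /punits /= ?oner_neq0 //.
  by rewrite mulf_neq0 ?invr_eq0.
- by move=> H [H_subgroup _]; apply: mul_subgroup1.
- move=> H HP; have [H_subgroup _] := HP.
  by apply: (mul_subgroup_div H_subgroup); [exact: Tx|exact: Ty].
Qed.

Lemma sub_T x : S x -> T x.
Proof. by move=> Sx; apply: sub_gen_smallest; left. Qed.

Lemma T_p_rigid x : x != 0 -> ~ T x -> power_cosets p S x (1 - x).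
Proof.
by move=> x0 Tx; apply: contrapT => nx; apply: Tx; apply: sub_gen_smallest; right.
Qed.

(** For the pair [x / u], [- x], the two non-rigid elements in [nonrigid_dependent] are [x] and [u].
    The pair is independent: if [x^(i + j) / u^i] is in [T], then [p] divides [i + j] since [x] is
    outside [adjoin T u], and then [i] since [u] is outside [T]. *)
Lemma adjoin_T_rigid u x : odd p -> u != 0 -> ~ T u -> ~ rigid S u ->
  x != 0 -> ~ adjoin T u x -> rigid S x.
Proof.
move=> p_odd u0 Tu nu x0 Tx; apply: contrapT => nx.
have T_subgroup := T_mul_subgroup.
have T_powers z : z != 0 -> T (z ^+ p) by move=> /S_powers/sub_T.
have [xu0 xN0] : x / u != 0 /\ - x != 0 by rewrite mulf_neq0 ?invr_eq0 ?oppr_eq0.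
have A_subgroup : mul_subgroup (adjoin T u).
  exact: (adjoin_subgroup T_subgroup (prime_gt0 p_prime) T_powers u0).
have A_powers z : z != 0 -> adjoin T u (z ^+ p) by move=> /T_powers/sub_adjoin.
apply: (@nonrigid_dependent _ 'F_p p S T (x / u) (- x) (pchar_Fp p_prime)) => //.
- by move=> m; exists (val m); rewrite natr_Zp.
- exact: sub_T.
- exact: T_p_rigid.
- move=> i j Tij.
  have e : (x / u) ^+ i * (- x) ^+ j = (-1) ^+ j * (x ^+ (i + j) / u ^+ i).
    by rewrite exprMn exprVn (exprNn x) exprD; ring.
  have TN : T ((-1) ^+ j) by apply: (mul_subgroupX T_subgroup); apply: sub_T.
  move: Tij; rewrite e (mul_subgroupMl T_subgroup _ TN) => Tij.
  have ui0 : u ^+ i != 0 by rewrite expf_neq0.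
  have pij : (p %| i + j)%N.
    apply/negPn/negP => pij; apply: Tx.
    apply: (mul_subgroup_expr_mem p_prime A_subgroup A_powers x0 pij).
    rewrite -(divfK ui0 (x ^+ _)); apply: (mul_subgroupM A_subgroup).
      exact: sub_adjoin.
    by apply: (mul_subgroupX A_subgroup); apply: (adjoin_gen p_prime T_powers).
  have pi : (p %| i)%N.
    apply/negPn/negP => pi; apply: Tu.
    apply: (mul_subgroup_expr_mem p_prime T_subgroup T_powers u0 pi).
    have [k kE] := dvdnP pij.
    have Txij : T (x ^+ (i + j)) by rewrite kE exprM; apply: T_powers; apply: expf_neq0.
    have := mul_subgroup_div T_subgroup Txij Tij.
    by rewrite invf_div mulrCA divff ?mulr1 // expf_neq0.
  by split; rewrite // -(dvdn_addr _ pi).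
- by rewrite opprK.
by rewrite (_ : - (- x / (x / u)) = u) //; fieldn.
Qed.

Lemma adjoin_T_valuation_ring :
  exists2 u, u != 0 & valuation_ring (rigid_ring S (adjoin T u)).
Proof.
have T_subgroup := T_mul_subgroup.
have T_powers z : z != 0 -> T (z ^+ p) by move=> /S_powers/sub_T.
have [p2|p_odd] := even_prime p_prime.
  have [|//|u [u0 uP]] := rigid_ring_valuation_two S_subgroup T_subgroup sub_T S_opp1.
  (* For [p = 2] only the exponents [0] and [1] occur, so [p]-rigid means rigid. *)
  - move=> x x0 /(T_p_rigid x0); rewrite p2 /rigid => -[[|[|//]] _ [s Ss]].
      by rewrite expr0 mul1r => <-; left.
    by rewrite expr1 => <-; right; rewrite mulrC mulKf.
  - by rewrite -p2.
  by exists u.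
(* Any non-rigid [u] outside [T] serves; if there is none, [u = 1] does. *)
have [u [u0 uP]] : exists u, u != 0 /\ forall x, x != 0 -> ~ adjoin T u x -> rigid S x.
  have [[u [u0 Tu nu]]|nex] := pselect (exists u, [/\ u != 0, ~ T u & ~ rigid S u]).
    by exists u; split=> // x; apply: adjoin_T_rigid.
  exists 1; split=> [|x x0 Tx]; first exact: oner_neq0.
  apply: contrapT => nx; apply: nex; exists x; split=> //.
  by move=> Tx'; apply/Tx/sub_adjoin.
exists u => //; have A_subgroup : mul_subgroup (adjoin T u).
  exact: (adjoin_subgroup T_subgroup (prime_gt0 p_prime) T_powers u0).
apply: rigid_ring_valuation_odd => // [x /sub_T/sub_adjoin//|x Hx2].
have x0 : x != 0.
  by have := mul_subgroup_neq0 A_subgroup Hx2; rewrite expf_eq0.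
apply: (mul_subgroup_expr_mem p_prime A_subgroup _ x0 _ Hx2).
  by move=> z z0; apply: sub_adjoin; apply: T_powers.
by rewrite dvdn_prime2 //; apply: contraTneq p_odd => ->.
Qed.

End MainTheorem.

Theorem theorem2p68 (K : fieldType) (p : nat) (S : set K)
    (p_prime : prime p)
    (S_subgroup : mul_subgroup S)
    (S_opp1 : S (- 1))
    (S_powers : forall x : K, x != 0 -> S (x ^+ p))
    (T_index : index_gt (T_ p S) p) :
  exists (G : porderZmodType) (v : K -> option G),
    [/\ valuation v, nontrivial_valuation v & ~ p_divisible_value_group p v].
Proof.
have T_subgroup := T_mul_subgroup p S_subgroup.
have T_powers z : z != 0 -> T_ p S (z ^+ p) by move=> /S_powers/sub_T.
have [u u0 O_valuation] := adjoin_T_valuation_ring p_prime S_subgroup S_opp1 S_powers.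
have A_subgroup : mul_subgroup (adjoin (T_ p S) u).
  exact: (adjoin_subgroup T_subgroup (prime_gt0 p_prime) T_powers u0).
apply: (valuation_ring_not_p_divisible O_valuation A_subgroup (prime_gt0 p_prime)).
- apply: rigid_ring_unit => //.
  by move=> x /sub_T/sub_adjoin.
- by move=> x x0; apply: sub_adjoin; apply: T_powers.
exact: (adjoin_proper p_prime T_subgroup T_powers T_index u0).
Qed.
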